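(* Let $X$ be a topological vector space, let $Y$ be a locally convex topological vector space ordered by a convex cone $Y_+$ with $\operatorname{int} Y_+\neq\emptyset$, let $D\subseteq X$ be nonempty, and let $f:X\to 2^Y$ be a set-valued map. Then the following four properties are equivalent: (5) ($f$ is presubconvexlike on $D$) there exists $\theta\in\operatorname{int}Y_+$ such that for all $x^1,x^2\in D$, all $\alpha\in(0,1)$ and all $\varepsilon>0$ there exist $x^3\in D$ and $\tau>0$ with $\varepsilon\theta+\alpha f(x^1)+(1-\alpha)f(x^2)\subseteq \tau f(x^3)+Y_+$. (6) ($f$ is presub-convexlike on $D$) there exists $u\in U$ such that for all $x^1,x^2\in D$, all $\alpha\in(0,1)$ and all $\varepsilon>0$ there exist $x^3\in D$ and $\tau>0$ with $\varepsilon u+\alpha f(x^1)+(1-\alpha)f(x^2)\subseteq \tau f(x^3)+Y_+$. (7) ($f$ is strictly presubconvexlike on $D$) there exists $\theta\in\operatorname{int}Y_+$ such that for all $x^1,x^2\in D$, all $\alpha\in(0,1)$ and all $\varepsilon>0$ there exist $x^3\in D$ and $\tau>0$ with $\varepsilon\theta+\alpha f(x^1)+(1-\alpha)f(x^2)\subseteq \tau f(x^3)+\operatorname{int}Y_+$. (8) ($f$ is strictly presub-convexlike on $D$) there exists $u\in U$ such that for all $x^1,x^2\in D$, all $\alpha\in(0,1)$ and all $\varepsilon>0$ there exist $x^3\in D$ and $\tau>0$ with $\varepsilon u+\alpha f(x^1)+(1-\alpha)f(x^2)\subseteq \tau f(x^3)+\operatorname{int}Y_+$. Here $U$ is the set of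 all bounded set-valued functions from $X$ to $2^Y$.
   Context: All vector spaces are real. $2^Y$ is the power set of $Y$. A subset $Y_+\subseteq Y$ is a convex cone if $\lambda_1y_1+\lambda_2y_2\in Y_+$ for all $y_1,y_2\in Y_+$ and all real $\lambda_1,\lambda_2\ge 0$; $\operatorname{int}Y_+$ is its interior. Sums and scalar multiples of sets are taken elementwise: $A+B=\{a+b:a\in A,b\in B\}$, $v+A=\{v+a:a\in A\}$, $\lambda A=\{\lambda a:a\in A\}$. A set-valued function $u:X\to 2^Y$ (with nonempty values) is bounded if its range $u(X)=\bigcup_{x\in X}u(x)$ is a bounded subset of $Y$. In an inclusion such as $\varepsilon u+A\subseteq B$, the symbol $u$ stands for the range $u(X)$, i.e. the inclusion means $\varepsilon u(x)+A\subseteq B$ for every $x\in X$. *)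

(* Defs.v *)
From mathcomp Require Import all_boot all_order all_algebra.
From mathcomp Require Import all_classical reals topology tvs.
Set Implicit Arguments.
Unset Strict Implicit.
Unset Printing Implicit Defensive.
Import Order.TTheory GRing.Theory Num.Theory.
Local Open Scope classical_set_scope.
Local Open Scope ring_scope.

Section Minkowski.
Context (R : numDomainType) (Y : lmodType R).
Implicit Types (A B : set Y) (v : Y) (c : R).

Definition setadd A B : set Y := [set a + b | a in A & b in B].
Definition settranslate v A : set Y := [set v + a | a in A].
Definition setscale c A : set Y := [set c *: a | a in A].

Definition convex_cone (Yp : set Y) : Prop :=
  forall (y1 y2 : Y) (l1 l2 : R), Yp y1 -> Yp y2 -> 0 <= l1 -> 0 <= l2 ->
    Yp (l1 *: y1 + l2 *: y2).

End Minkowski.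

Notation "A :+: B" := (setadd A B)
  (at level 50, left associativity) : classical_set_scope.
Notation "v :+ A" := (settranslate v A)
  (at level 50, left associativity) : classical_set_scope.
Notation "c :*: A" := (setscale c A)
  (at level 40, left associativity) : classical_set_scope.

Section Presubconvexlike.
Context (R : realType) (X : Type) (Y : tvsType R).
Implicit Types (Yp A : set Y) (D : set X) (f u : X -> set Y).

(* Boundedness in a topological vector space (von Neumann): every
   neighbourhood V of 0 satisfies A `<=` t V for all sufficiently large t.
   The library's [bounded_set] is only available for normed modules. *)
Definition tvs_bounded A : Prop :=
  forall V : set Y, nbhs (0 : Y) V ->
    exists2 s : R, 0 < s & forall t : R, s < t -> A `<=` t :*: V.

Definition bounded_setfun : set (X -> set Y) :=
  [set u | (forall x, u x !=set0) /\ tvs_bounded (\bigcup_x u x)].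

Definition presubconvexlike Yp D f : Prop :=
  exists2 theta : Y, Yp° theta &
  forall (x1 x2 : X) (alpha eps : R), D x1 -> D x2 -> 0 < alpha < 1 -> 0 < eps ->
  exists (x3 : X) (tau : R), [/\ D x3, 0 < tau &
    (eps *: theta) :+ (alpha :*: f x1 :+: (1 - alpha) :*: f x2)
      `<=` tau :*: f x3 :+: Yp].

(* An inclusion involving u is an inclusion for every value u x; the point x3
   and the scalar tau do not depend on x. *)
Definition presub_convexlike Yp D f : Prop :=
  exists2 u : X -> set Y, bounded_setfun u &
  forall (x1 x2 : X) (alpha eps : R), D x1 -> D x2 -> 0 < alpha < 1 -> 0 < eps ->
  exists (x3 : X) (tau : R), [/\ D x3, 0 < tau &
    forall x : X, eps :*: u x :+: alpha :*: f x1 :+: (1 - alpha) :*: f x2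
      `<=` tau :*: f x3 :+: Yp].

Definition strictly_presubconvexlike Yp D f : Prop :=
  exists2 theta : Y, Yp° theta &
  forall (x1 x2 : X) (alpha eps : R), D x1 -> D x2 -> 0 < alpha < 1 -> 0 < eps ->
  exists (x3 : X) (tau : R), [/\ D x3, 0 < tau &
    (eps *: theta) :+ (alpha :*: f x1 :+: (1 - alpha) :*: f x2)
      `<=` tau :*: f x3 :+: Yp°].

Definition strictly_presub_convexlike Yp D f : Prop :=
  exists2 u : X -> set Y, bounded_setfun u &
  forall (x1 x2 : X) (alpha eps : R), D x1 -> D x2 -> 0 < alpha < 1 -> 0 < eps ->
  exists (x3 : X) (tau : R), [/\ D x3, 0 < tau &
    forall x : X, eps :*: u x :+: alpha :*: f x1 :+: (1 - alpha) :*: f x2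
      `<=` tau :*: f x3 :+: Yp°].

End Presubconvexlike.

(* Main.v *)
Require Import Defs.
From mathcomp Require Import all_boot all_order all_algebra.
From mathcomp Require Import all_classical reals topology tvs.
Import Order.TTheory GRing.Theory Num.Theory.
Local Open Scope classical_set_scope.
Local Open Scope ring_scope.

(** A vector [theta] is the same thing as the constant map with value
    [ [set theta] ], which is bounded; so each property with a vector of
    [Yp°] implies its counterpart with a bounded set-valued map, and each strict
    property implies the weak one because [Yp° `<=` Yp].

    The only implication with content goes from the weak property with a
    bounded map [u] to the strict property with an interior vector. Choose any
    [theta] in [Yp°]. Boundedness of the range of [u] gives one large [t] such
    that [theta - t^-1 *: b] is in [Yp°] for every value [b] of [u]
    ([interior_absorbs_bounded]). Then
    [[
      eps theta + w = eps (theta - t^-1 b) + ((eps / t) b + w),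
    ]]
    where the first summand is in [Yp°] and the second is in
    [tau f(x3) + Yp], by the hypothesis for [eps / t]. Since
    [Yp° + Yp `<=` Yp°] for a convex cone, the sum is in [tau f(x3) + Yp°].
    This works for every [theta] in [Yp°], so the nonemptiness of [Yp°] is
    enough to close the cycle of implications. *)

Section ConeInterior.
Context (R : realType) (Y : tvsType R) (Yp : set Y).
Context (Ypcone : convex_cone Yp).
Implicit Types (a b theta : Y) (B : set Y).

Lemma interior_coneD a b : Yp° a -> Yp b -> Yp° (a + b).
Proof.
move=> Ya Yb; rewrite addrC; change (nbhs (b + a) Yp).
apply: filterS (nbhsB _ Ya) => _ [y Yy <-].
by have := Ypcone _ _ 1 1 Yb Yy ler01 ler01; rewrite !scale1r.
Qed.

Lemma interior_coneZ (c : R) a : 0 < c -> Yp° a -> Yp° (c *: a).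
Proof.
move=> c0 Ya; change (nbhs (c *: a) Yp).
apply: filterS (nbhsZ (lt0r_neq0 c0) Ya) => _ [y Yy <-].
by have := Ypcone _ _ c 0 Yy Yy (ltW c0) (lexx _); rewrite scale0r addr0.
Qed.

(** The vectors [v] with [theta - v] in [Yp°] form a neighbourhood of [0], and
    a bounded set lies in its [t]-fold dilation as soon as [t] is large. *)
Lemma interior_absorbs_bounded theta B : Yp° theta -> tvs_bounded B ->
  exists2 t : R, 0 < t & forall b, B b -> Yp° (theta - t^-1 *: b).
Proof.
move=> Yth Bbnd.
have V0 : nbhs (0 : Y) [set v | Yp° (theta - v)].
  have : nbhs (0 : Y) (+%R (- theta) @` Yp°).
    rewrite -(addNr theta); apply: nbhsB.
    exact: open_nbhs_nbhs (conj (open_interior _) Yth).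
  have N1 : -1 != 0 :> R by rewrite oppr_eq0 oner_eq0.
  move=> /(nbhs0Z N1); apply: filterS => _ [_ [y Yy <-] <-] /=.
  by rewrite scaleN1r opprD opprK opprB addrC subrK.
have [s s0 Bs] := Bbnd _ V0.
have t0 : 0 < s + 1 by rewrite addr_gt0.
have s_lt : s < s + 1 by rewrite ltrDl.
exists (s + 1) => // _ /(Bs _ s_lt)[v Yv <-].
by rewrite scalerA mulVf ?scale1r ?gt_eqF.
Qed.

End ConeInterior.

Section ConstantSetfun.
Context (R : realType) (Y : tvsType R).

(** By continuity of the scaling at [(0, y)], a given neighbourhood of [0]
    contains [t^-1 *: y] when [t] is large. *)
Lemma tvs_bounded_set1 (y : Y) : tvs_bounded [set y].
Proof.
move=> V V0.
have := @scale_continuous R Y (0, y) V; rewrite /= scale0r => /(_ V0).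
move=> [[A B] /= [/nbhs_ballP[r /= r0 rA] yB] ABV].
exists r^-1; rewrite ?invr_gt0// => t rt _ ->.
have t0 : 0 < t by rewrite (lt_trans _ rt)// invr_gt0.
exists (t^-1 *: y); last by rewrite scalerA mulfV ?scale1r ?gt_eqF.
apply: (ABV (t^-1, y)); split=> /=; last exact: nbhs_singleton.
apply: rA; rewrite /ball /= sub0r normrN gtr0_norm ?invr_gt0//.
by rewrite -[r]invrK ltf_pV2// posrE ?invr_gt0.
Qed.

Lemma bounded_setfun_cst (X : Type) (y : Y) :
  bounded_setfun (fun _ : X => [set y]).
Proof.
split=> [_|]; first by exists y.
move=> V /(tvs_bounded_set1 y)[s s0 yV]; exists s => // t st _ [x _ ->].
exact: yV.
Qed.

Lemma setscale_set1D (eps : R) (y : Y) (A B : set Y) :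
  eps :*: [set y] :+: A :+: B `<=` (eps *: y) :+ (A :+: B).
Proof.
move=> _ [_ [_ [_ -> <-] [a Aa <-]] [b Bb <-]].
by exists (a + b); [exists a => //; exists b | rewrite addrA].
Qed.

End ConstantSetfun.

Section Implications.
Context (R : realType) (X : Type) (Y : tvsType R).
Context (Yp : set Y) (D : set X) (f : X -> set Y).

Lemma presubconvexlike_presub_convexlike :
  presubconvexlike Yp D f -> presub_convexlike Yp D f.
Proof.
move=> [theta _ H]; exists (fun _ => [set theta]).
  exact: bounded_setfun_cst.
move=> x1 x2 alpha eps Dx1 Dx2 alpha01 eps0.
have [x3 [tau [Dx3 tau0 incl]]] := H _ _ _ _ Dx1 Dx2 alpha01 eps0.
exists x3, tau; split=> // _.
exact: subset_trans (setscale_set1D _ _ _ _ _ _) incl.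
Qed.

Lemma strictly_presubconvexlike_strictly_presub_convexlike :
  strictly_presubconvexlike Yp D f -> strictly_presub_convexlike Yp D f.
Proof.
move=> [theta _ H]; exists (fun _ => [set theta]).
  exact: bounded_setfun_cst.
move=> x1 x2 alpha eps Dx1 Dx2 alpha01 eps0.
have [x3 [tau [Dx3 tau0 incl]]] := H _ _ _ _ Dx1 Dx2 alpha01 eps0.
exists x3, tau; split=> // _.
exact: subset_trans (setscale_set1D _ _ _ _ _ _) incl.
Qed.

Lemma setadd_interior (A : set Y) : A :+: Yp° `<=` A :+: Yp.
Proof.
by move=> _ [a Aa [y Yy <-]]; exists a => //; exists y => //; exact: interior_subset.
Qed.

Lemma strictly_presubconvexlike_presubconvexlike :
  strictly_presubconvexlike Yp D f -> presubconvexlike Yp D f.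
Proof.
move=> [theta Yth H]; exists theta => // x1 x2 alpha eps Dx1 Dx2 alpha01 eps0.
have [x3 [tau [Dx3 tau0 incl]]] := H _ _ _ _ Dx1 Dx2 alpha01 eps0.
by exists x3, tau; split=> //; exact: subset_trans incl (setadd_interior _).
Qed.

Lemma strictly_presub_convexlike_presub_convexlike :
  strictly_presub_convexlike Yp D f -> presub_convexlike Yp D f.
Proof.
move=> [u ubnd H]; exists u => // x1 x2 alpha eps Dx1 Dx2 alpha01 eps0.
have [x3 [tau [Dx3 tau0 incl]]] := H _ _ _ _ Dx1 Dx2 alpha01 eps0.
by exists x3, tau; split=> // x; exact: subset_trans (incl x) (setadd_interior _).
Qed.

(** An interior vector absorbs the bounded perturbation: with [b] a value of
    [u], the hypothesis is used for [eps / t] instead of [eps], and the rest of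
    [eps *: theta], namely [eps *: (theta - t^-1 *: b)], moves the sum into the
    interior. *)
Lemma presub_convexlike_strictly_presubconvexlike :
  convex_cone Yp -> Yp° !=set0 ->
  presub_convexlike Yp D f -> strictly_presubconvexlike Yp D f.
Proof.
move=> Ypcone [theta Yth] [u [une ubnd] H]; exists theta => //.
have [t t0 Yt] := interior_absorbs_bounded _ _ _ _ _ Yth ubnd.
move=> x1 x2 alpha eps Dx1 Dx2 alpha01 eps0.
have [x3 [tau [Dx3 tau0 incl]]] :=
  H _ _ _ _ Dx1 Dx2 alpha01 (divr_gt0 eps0 t0).
exists x3, tau; split=> // _ [_ [a Aa [c Cc <-]] <-].
have [b ub] := une x1.
have [|z fz [y Yy zyE]] := incl x1 ((eps / t) *: b + a + c).
  exists ((eps / t) *: b + a); last by exists c.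
  by exists ((eps / t) *: b); [exists b | exists a].
exists z => //; exists (eps *: (theta - t^-1 *: b) + y).
  by apply: interior_coneD => //; apply: interior_coneZ => //; apply: Yt; exists x1.
by rewrite addrCA zyE scalerBr scalerA !addrA subrK.
Qed.

End Implications.

Theorem theorem2 (R : realType) (X : topologicalLmodType R) (Y : tvsType R)
    (Yp : set Y) (D : set X) (f : X -> set Y) :
  convex_cone Yp -> Yp° !=set0 -> D !=set0 ->
  [<-> presubconvexlike Yp D f;
       presub_convexlike Yp D f;
       strictly_presubconvexlike Yp D f;
       strictly_presub_convexlike Yp D f].
Proof.
move=> Ypcone Yp0 _.
have weak_strict := presub_convexlike_strictly_presubconvexlike
  _ _ _ _ D f Ypcone Yp0.
tfae.
- exact: presubconvexlike_presub_convexlike.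
- exact: weak_strict.
- exact: strictly_presubconvexlike_strictly_presub_convexlike.
- move=> /strictly_presub_convexlike_presub_convexlike/weak_strict.
  exact: strictly_presubconvexlike_presubconvexlike.
Qed.
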